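(* Let $D$ be an integral domain. Then $D$ is a 1-dimensional, integrally closed, $b$-Noetherian domain if and only if $D$ is a Dedekind domain (not a field).
   Context: Let $D$ be an integral domain with quotient field $K$. An overring of $D$ is a ring $T$ with $D\subseteq T\subseteq K$; a valuation overring is an overring which is a valuation domain. For each nonzero $D$-submodule $E$ of $K$ set $E^b:=\bigcap\{EV \mid V \text{ valuation overring of } D\}$. A quasi-$b$-ideal of $D$ is a nonzero ideal $I$ of $D$ with $I^b\cap D=I$. $D$ is $b$-Noetherian if the ascending chain condition holds on quasi-$b$-ideals of $D$; equivalently, for each nonzero ideal $I$ of $D$ there is a finitely generated ideal $F\subseteq I$ with $F^b=I^b$. Dimension means Krull dimension. *)

(* Defs.v *)
From HB Require Import structures.
From mathcomp Require Import all_boot all_order all_algebra.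
From mathcomp Require Import boolp classical_sets.

Set Implicit Arguments.
Unset Strict Implicit.
Unset Printing Implicit Defensive.

Import GRing.Theory.
Local Open Scope classical_set_scope.
Local Open Scope ring_scope.

(* Subsets are classical sets, viewed as boolean predicates ([in A]) where the
   algebraic closure predicates expect such. *)

(* An ideal of D is a submodule of the regular module D^o; it may be the whole
   ring. *)
Definition ideal (D : idomainType) (I : set D) : Prop :=
  GRing.submod_closed ([in I] : {pred D^o}).

Definition nonzero_ideal (D : idomainType) (I : set D) : Prop :=
  ideal I /\ exists2 x, I x & x != 0.

(* Properness (1 \notin P) is part of idealr_closed. *)
Definition prime_ideal (D : idomainType) (P : set D) : Prop :=
  idealr_closed [in P] /\ prime_idealr_closed [in P].

Definition maximal_ideal (D : idomainType) (M : set D) : Prop :=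
  idealr_closed [in M] /\
  forall J : set D, idealr_closed [in J] -> M `<=` J -> J = M.

Definition ascending_chain_condition (T : Type) (C : set (set T)) : Prop :=
  forall I : nat -> set T,
    (forall n, C (I n)) -> (forall n, I n `<=` I n.+1) ->
    exists N, forall n, (N <= n)%N -> I n = I N.

Definition overring (D : idomainType) (T : set {fraction D}) : Prop :=
  GRing.subring_closed [in T] /\ forall d : D, T (tofrac d).

(* The quotient field of any overring of D is {fraction D}, so being a valuation
   domain is tested on the elements of {fraction D}. The field {fraction D}
   itself counts as a valuation overring. *)
Definition valuation_overring (D : idomainType) (V : set {fraction D}) : Prop :=
  overring V /\ forall x : {fraction D}, x != 0 -> V x \/ V x^-1.

Definition module_product (K : fieldType) (E V : set K) : set K :=
  [set x | exists n : nat, exists e v : 'I_n -> K,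
     [/\ forall i, E (e i), forall i, V (v i) & x = \sum_(i < n) e i * v i]].

(* Defined for every subset E of {fraction D}, but only meant for (and below only
   applied to) nonzero D-submodules. *)
Definition b_closure (D : idomainType) (E : set {fraction D}) :
    set {fraction D} :=
  [set x | forall V, @valuation_overring D V -> module_product E V x].

Definition quasi_b_ideal (D : idomainType) (I : set D) : Prop :=
  nonzero_ideal I /\
  (@tofrac D) @^-1` (b_closure ((@tofrac D) @` I)) = I.

Definition b_noetherian (D : idomainType) : Prop :=
  ascending_chain_condition (@quasi_b_ideal D).

(* P 0, ..., P n is a strictly increasing chain of n + 1 primes; the values of P
   beyond n are irrelevant. *)
Definition prime_chain (D : idomainType) (n : nat) (P : nat -> set D) : Prop :=
  (forall i, (i <= n)%N -> prime_ideal (P i)) /\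
  (forall i, (i < n)%N -> P i `<` P i.+1).

Definition has_krull_dim (D : idomainType) (n : nat) : Prop :=
  (exists P : nat -> set D, prime_chain n P) /\
  (forall (m : nat) (P : nat -> set D), prime_chain m P -> (m <= n)%N).

Definition integrally_closed (D : idomainType) : Prop :=
  forall z : {fraction D},
    integralOver (@tofrac D) z -> exists d : D, z = tofrac d.

Definition noetherian (D : idomainType) : Prop :=
  ascending_chain_condition (@ideal D).

(* Fields are Dedekind domains under this convention. *)
Definition dedekind (D : idomainType) : Prop :=
  [/\ noetherian D, integrally_closed D &
      forall P : set D, prime_ideal P -> P <> [set 0] ->
        maximal_ideal P].

Definition is_field (D : idomainType) : Prop :=
  forall x : D, x != 0 -> x \is a GRing.unit.

(* Main.v *)
Require Import Defs.
From HB Require Import structures.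
From mathcomp Require Import all_boot all_order all_algebra.
From mathcomp Require Import boolp classical_sets.

(** A Dedekind domain is Noetherian, and
    quasi-b-ideals are ideals, so it is b-Noetherian; its dimension is 1 because
    nonzero primes are maximal and a non-unit lies in some maximal ideal.

    Conversely, let D be 1-dimensional, integrally closed and b-Noetherian. Only
    the ascending chain condition on all ideals needs an argument, and it
    suffices to show that every nonzero ideal is a quasi-b-ideal. Because D is
    the intersection of its valuation overrings ([integral_of_mem_valuations]),
    every divisorial ideal, that is, every intersection of fractional principal
    ideals cut down to D, is a quasi-b-ideal ([divisorial_quasi_b]). So the goal
    becomes: every nonzero ideal I is divisorial
    ([nonzero_ideal_divisorial]). Two consequences of the chain condition give
    this.

    - D is completely integrally closed: if a is nonzero and every a z^n lies in
      D, then z is in D ([completely_integrally_closed]). In a valuation ring V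
      that misses z, the fractional ideals generated by a, a z, ..., a z^n form
      a strictly increasing sequence in n, while their traces on D must become
      stationary.
    - For a nonzero prime M there is z outside D with M z inside D
      ([minimal_prime_multiplier]). Among the conductors (D : z) that are
      contained in M and contain a given nonzero element of M there is a maximal
      one; it is prime, hence equal to M by dimension 1.

    Now suppose that d lies in every fractional principal ideal containing I but
    not in I. The proper ideal of all x with x d in I lies in a maximal ideal M;
    take z for M as above. The choice of d gives d w in D for every w with I w
    inside D, so i w d is in I, that is, i w is in M, hence i w z is in D.
    Thus w z again multiplies I into D; starting from w = 1, every z^n multiplies
    I into D. Complete integral closedness puts z in D, a contradiction. *)

Set Implicit Arguments.
Unset Strict Implicit.
Unset Printing Implicit Defensive.

Import GRing.Theory.
Local Open Scope classical_set_scope.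
Local Open Scope ring_scope.

(** * Maximal members of families of sets *)

Lemma chain_upper2 (T : Type) (F : set (set T)) (X Y : set T) :
  total_on F subset -> F X -> F Y ->
  exists Z, [/\ F Z, X `<=` Z & Y `<=` Z].
Proof.
by move=> tF FX FY; case: (tF _ _ FX FY) => XY; [exists Y|exists X]; split.
Qed.

(** The property [P] may fail for the empty set (it does for ideals and subrings),
    so Zorn's lemma is applied to the sets [A] such that [P] holds of the union
    of [A0] and [A]. *)
Lemma Zorn_above (T : Type) (P : set (set T)) (A0 : set T) :
    P A0 ->
    (forall F : set (set T), F !=set0 -> F `<=` P -> total_on F subset ->
       P (\bigcup_(X in F) X)) ->
  exists A, [/\ P A, A0 `<=` A & forall B, P B -> A `<=` B -> B = A].
Proof.
move=> PA0 Pcup.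
have [F FQ tF|A [QA maxA]] := @Zorn_bigcup T [set A | P (A0 `|` A)].
  have [->|F0] := eqVneq F set0; first by rewrite /= bigcup_set0 setU0.
  have /set0P[X FX] := F0.
  rewrite /= setUC -bigcupUl; last exact/set0P.
  pose G := [set Y | exists2 Z, F Z & Y = Z `|` A0].
  rewrite (_ : \bigcup_(Y in F) _ = \bigcup_(Y in G) Y); last first.
    rewrite eqEsubset; split=> x.
      by case=> Y FY ?; exists (Y `|` A0) => //; exists Y.
    by case=> _ [Y FY ->] ?; exists Y.
  apply: Pcup; first by exists (X `|` A0); exists X.
    by move=> _ [Y FY ->]; rewrite setUC; apply: FQ.
  move=> _ _ [Y FY ->] [Z FZ ->].
  by case: (tF _ _ FY FZ) => YZ; [left|right]; apply: setSU.
exists (A0 `|` A); split=> // B PB AB.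
have /setUidPr A0B : A0 `<=` B by move=> x ?; apply: AB; left.
apply/esym/seteqP; split=> // x Bx; right.
apply: contrapT => nAx; apply: (maxA B); last by rewrite /= A0B.
by split=> [y Ay|BA]; [apply: AB; right|apply/nAx/BA].
Qed.

Lemma acc_maximal (T : Type) (C C' : set (set T)) :
  ascending_chain_condition C -> C' `<=` C -> C' !=set0 ->
  exists2 A, C' A & forall B, C' B -> A `<=` B -> B = A.
Proof.
move=> acc CC' [A0 CA0]; apply: contrapT => nmax.
have step (A : {A | C' A}) : {B : {A | C' A} | sval A `<` sval B}.
  apply: cid; apply: contrapT => nB; apply: nmax; exists (sval A); first exact: svalP.
  move=> B CB AB; apply: contrapT => nBA; apply: nB; exists (exist _ B CB).
  by split=> // BA; apply: nBA; apply/seteqP.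
pose F n := iter n (fun A => sval (step A)) (exist _ A0 CA0).
have FS n : sval (F n) `<` sval (F n.+1) by exact: svalP (step (F n)).
have [|n|N /(_ N.+1 (leqnSn N)) FN] := acc (fun n => sval (F n)).
- by move=> n; apply/CC'/svalP.
- by have [] := FS n.
- by have [_] := FS N; rewrite FN; apply.
Qed.

(** * Integrality over a subring of a field *)

(** Membership predicates carry no ring structure, whereas integrality and
    polynomials ask for a coefficient ring; this turns a subring into one. *)
Lemma subring_as_image (K : fieldType) (A : set K) :
  GRing.subring_closed [in A] ->
  exists (R : comNzRingType) (f : {rmorphism R -> K}),
    injective f /\ A = range f.
Proof.
move=> clA.
pose S : subringClosed K :=
  HB.pack ([in A] : {pred K}) (GRing.isSubringClosed.Build K [in A] clA).
pose R1 := {x : K | x \in S}.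
pose R2 : GRing.SubChoice_isSubComNzRing K (fun x => x \in S) R1 :=
  [SubChoice_isSubComNzRing of R1 by <:].
pose R3 : subComNzRingType (fun x => x \in S) := HB.pack R1 R2.
exists R3, (val : {rmorphism R3 -> K}); split; first exact: val_inj.
rewrite eqEsubset; split=> [x /mem_set Ax|_ [u _ <-]].
  by exists (Sub x Ax : R3) => //; rewrite SubK.
exact: set_mem (valP u).
Qed.

Section Adjunction.
Variables (R : comNzRingType) (K : fieldType) (f : {rmorphism R -> K}).

(** The subring generated by [w] over the image of [f]. *)
Definition adjoin (w : K) : set K := [set (map_poly f p).[w] | p in setT].

Lemma adjoin_subring w : GRing.subring_closed [in adjoin w].
Proof.
split=> [|x y|x y]; rewrite !inE.
- by exists 1; rewrite // rmorph1 hornerC.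
- by move=> [p _ <-] [q _ <-]; exists (p - q); rewrite // rmorphB hornerD hornerN.
- by move=> [p _ <-] [q _ <-]; exists (p * q); rewrite // rmorphM hornerM.
Qed.

Lemma adjoin_base w a : adjoin w (f a).
Proof. by exists a%:P; rewrite // map_polyC hornerC. Qed.

Lemma adjoin_gen w : adjoin w w.
Proof. by exists 'X; rewrite // map_polyX hornerX. Qed.

(** Reversing the coefficients of [p] turns the constant term 1 into a leading
    coefficient and the root [x^-1] into the root [x]. *)
Lemma integral_of_inverse_root (p : {poly R}) (x : K) :
  x != 0 -> p`_0 = 1 -> root (map_poly f p) x^-1 -> integralOver f x.
Proof.
move=> x0 p01 /eqP px.
have n0 : (0 < size p)%N.
  by rewrite size_poly_gt0; apply: contra_eq_neq p01 => ->; rewrite coef0 eq_sym oner_neq0.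
pose q := \poly_(i < size p) p`_((size p).-1 - i).
have qlead : q`_(size p).-1 = 1 by rewrite coef_poly prednK // leqnn subnn.
have sq : size q = size p by apply: size_poly_eq; rewrite subnn p01 oner_neq0.
exists q; first by rewrite monicE lead_coefE sq qlead.
rewrite /root (@horner_coef_wide _ (size p)); last first.
  by rewrite -sq; apply: size_poly.
rewrite (reindex_inj rev_ord_inj) /=.
rewrite (eq_bigr (fun i : 'I_(size p) => x ^+ (size p).-1 * ((map_poly f p)`_i * x^-1 ^+ i))).
  by rewrite -big_distrr /= -(@horner_coef_wide _ _ (map_poly f p)) ?size_poly // px mulr0.
move=> i _; have lei : (i <= (size p).-1)%N by rewrite -ltnS prednK.
rewrite !coef_map coef_poly subnS.
have -> : ((size p - i).-1 < size p)%N by rewrite -subnS ltn_subrL.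
have -> : (size p - i).-1 = ((size p).-1 - i)%N by rewrite -!subn1 subnAC.
by rewrite subKn // mulrCA -{2}(subnK lei) exprD exprVn mulfK // expf_neq0.
Qed.

(** If [x = q(1/x)], then [1 - X q] vanishes at [1/x] and has constant
    term 1. *)
Lemma integral_of_adjoin_inv x :
  x != 0 -> adjoin x^-1 x -> integralOver f x.
Proof.
move=> x0 [q _ qx].
apply: (@integral_of_inverse_root (1 - 'X * q)) => //.
  by rewrite coefB coef1 coefXM subr0.
by rewrite /root rmorphB rmorphM rmorph1 /= map_polyX !hornerE qx mulVf ?subrr.
Qed.

Lemma adjoin_integral x z : integralOver f x -> adjoin x z -> integralOver f z.
Proof.
move=> intx [p _ <-]; apply: integral_horner intx.
by apply/integral_poly => i; rewrite coef_map; apply: integral_id.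
Qed.

(** Multiplying the equation [z^n + ... = 0] by [z^(1-n)] expresses [z] as a
    polynomial in [z^-1]. *)
Lemma integral_with_inverse z y : z != 0 -> f y = z^-1 -> integralOver f z -> range f z.
Proof.
move=> z0 fy [p pm /eqP pz].
have [n sp] : exists n, size p = n.+1.
  by exists (size p).-1; rewrite prednK // size_poly_gt0 monic_neq0.
move: pz; rewrite (@horner_coef_wide _ n.+1); last by rewrite -sp size_poly.
have pn : p`_n = 1 by have := monicP pm; rewrite lead_coefE sp.
rewrite big_ord_recr /= coef_map /= pn rmorph1 mul1r => /addr0_eq/esym zn.
exists (- \sum_(i < n) p`_i * y ^+ (n.-1 - i)) => //.
have [n0|n0] := posnP n.
  by move: zn; rewrite n0 big_ord0 oppr0 expr0 => /eqP; rewrite oner_eq0.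
transitivity (z ^+ n * z^-1 ^+ n.-1); last first.
  by rewrite -{1}(prednK n0) exprS exprVn mulfK // expf_neq0.
rewrite zn mulNr rmorphN rmorph_sum big_distrl /=; congr (- _).
apply: eq_bigr => i _; rewrite coef_map rmorphM rmorphXn fy -mulrA; congr (_ * _).
have lei : (i <= n.-1)%N by rewrite -ltnS prednK.
by rewrite -{2}(subnK lei) addnC exprD mulrA exprVn mulfV ?mul1r // expf_neq0.
Qed.
End Adjunction.

(** * Valuation overrings and integral closure *)

Lemma subringP (K : fieldType) (V : set K) : GRing.subring_closed [in V] ->
  [/\ V 0, V 1, forall x y, V x -> V y -> V (x + y), forall x y, V x -> V y -> V (x - y) &
      forall x y, V x -> V y -> V (x * y)].
Proof.
move=> [V1 VB VM]; have V1' := set_mem V1.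
have subV x y : V x -> V y -> V (x - y).
  by move=> /mem_set Vx /mem_set Vy; apply/set_mem/VB.
have V0 : V 0 by rewrite -(subrr 1); apply: subV.
split=> // x y Vx Vy; last by apply/set_mem/VM; apply/mem_set.
by rewrite -[y]opprK; apply: (subV) => //; rewrite -sub0r; apply: (subV).
Qed.

(** By maximality every [w] outside [V] satisfies [z \in V[w]]. This first shows
    that [z^-1] lies in the Jacobson radical of [V]. If both [x] and [x^-1] were
    outside [V], then [z = q(x^-1)], and the equation [1 = z^-1 q(x^-1)], whose
    constant term can be moved to the left and divided out, makes [x] integral
    over [V]. Then [z \in V[x]] is integral over [V] too, and belongs to [V]
    because [z^-1] does. *)
Lemma maximal_avoiding_valuation (K : fieldType) (V : set K) (z : K) :
    GRing.subring_closed [in V] -> V z^-1 -> ~ V z ->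
    (forall B : set K, GRing.subring_closed [in B] -> ~ B z -> V `<=` B -> B = V) ->
  forall x, x != 0 -> V x \/ V x^-1.
Proof.
move=> clV Vy nVz maxV.
have z0 : z != 0.
  by apply: contra_notN nVz => /eqP ->; have [] := subringP clV.
have [R [f [fI Vf]]] := subring_as_image clV.
have adjz w : ~ V w -> adjoin f w z.
  move=> nVw; apply: contrapT => nz; apply: nVw.
  rewrite -(maxV _ (adjoin_subring f w) nz); first exact: adjoin_gen.
  by rewrite Vf => _ [a _ <-]; apply: adjoin_base.
have [V0 V1 VD VB VM] := subringP clV.
have VX u n : V u -> V (u ^+ n).
  by move=> Vu; elim: n => [|n IHn]; rewrite ?expr0 // exprS; apply: VM.
have unitV b : V b -> 1 - z^-1 * b != 0 /\ V (1 - z^-1 * b)^-1.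
  set u := 1 - _ => Vb.
  have Vu : V u by apply: VB => //; apply: VM.
  have u0 : u != 0.
    apply: contra_notN nVz; rewrite /u subr_eq0 eq_sym => /eqP/(canRL (mulKf _)).
    by rewrite invr_eq0 invrK mulr1 => <-.
  split=> //; apply: contrapT => /adjz[p _ pz]; apply: nVz.
  (* Both [u^n z], which clears the denominators of [p(u^-1)], and
     [(1 - u^n) z], a multiple of [(1 - u) z = b], are in [V]. *)
  have Vpart : V (u ^+ size p * z).
    rewrite -pz (@horner_coef_wide _ (size p)) ?size_poly // big_distrr /=.
    elim/big_ind: _ => // i _; rewrite coef_map mulrCA; apply: VM.
      by rewrite Vf; exists p`_i.
    by rewrite -{1}(subnK (ltnW (ltn_ord i))) exprD exprVn mulfK ?expf_neq0 //; apply: VX.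
  have Vrest : V ((1 - u ^+ size p) * z).
    rewrite -opprB subrX1 -mulNr opprB mulrAC.
    apply: VM; last by elim/big_ind: _ => // i _; apply: VX.
    by rewrite /u opprB addrC subrK mulrC mulrA divff // mul1r.
  by rewrite -[z]mul1r -[1](subrK (u ^+ size p)) mulrDl; apply: VD.
move=> x x0; apply: contrapT => /not_orP[nVx nVx'].
have [q _ qx] := adjz _ nVx'.
have [y _ fy] : range f z^-1 by rewrite -Vf.
have [|u0] := unitV (f q`_0); first by rewrite Vf; exists q`_0.
rewrite Vf => -[c _ fc].
have intx : integralOver f x.
  (* [c] is the inverse of the constant term of [1 - y q]. *)
  apply: (@integral_of_inverse_root _ _ _ (c%:P * (1 - y%:P * q))) => //.
    apply: fI; rewrite coefCM coefB coef1 coefCM rmorphM rmorphB rmorphM !rmorph1.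
    by rewrite fy fc mulVf.
  rewrite /root !(rmorphB, rmorphM, rmorph1) /= !map_polyC !hornerE qx.
  by rewrite /= fy mulVf // subrr mulr0.
have := adjoin_integral intx (adjz _ nVx).
by move/(integral_with_inverse z0 fy); rewrite -Vf.
Qed.

(** If [z] is not integral, then [z] is not in [D[1/z]], and a subring that is
    maximal among those containing [D[1/z]] and missing [z] is a valuation
    overring. *)
Lemma integral_of_mem_valuations (D : idomainType) (z : {fraction D}) :
    (forall V, @valuation_overring D V -> V z) -> integralOver (@tofrac D) z.
Proof.
move=> allV; apply: contrapT => nint.
have z0 : z != 0 by apply: contra_notN nint => /eqP ->; apply: integral0.
pose P (B : set {fraction D}) :=
  [/\ GRing.subring_closed [in B], adjoin (@tofrac D) z^-1 `<=` B & ~ B z].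
have [||V [[clV AV nVz] _ maxV]] := @Zorn_above _ P (adjoin (@tofrac D) z^-1).
- split=> //; first exact: adjoin_subring.
  by move/(integral_of_adjoin_inv z0).
- move=> F [X0 FX0] FP tF; split.
  + have [[X01 _ _] _ _] := FP _ FX0.
    split=> [|x y /set_mem[X FX Xx] /set_mem[Y FY Yy]|x y /set_mem[X FX Xx] /set_mem[Y FY Yy]].
    * by apply/mem_set; exists X0 => //; apply: set_mem.
    * have [Z [FZ XZ YZ]] := chain_upper2 tF FX FY.
      have [/subringP[_ _ _ ZB _] _ _] := FP _ FZ.
      by apply/mem_set; exists Z => //; apply: ZB; auto.
    * have [Z [FZ XZ YZ]] := chain_upper2 tF FX FY.
      have [/subringP[_ _ _ _ ZM] _ _] := FP _ FZ.
      by apply/mem_set; exists Z => //; apply: ZM; auto.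
  + by move=> x Ax; exists X0 => //; have [_ AX0 _] := FP _ FX0; apply: AX0.
  + by move=> [X /FP[_ _ nXz] /nXz].
apply: (nVz); apply: allV; split.
  by split=> // d; apply/AV/adjoin_base.
apply: (@maximal_avoiding_valuation _ V z) => //; first exact/AV/adjoin_gen.
move=> B clB nBz VB; apply: maxV => //; split=> //; exact: subset_trans VB.
Qed.

(** * Prime and maximal ideals *)

Lemma idealP (D : idomainType) (I : set D) :
  ideal I <-> I 0 /\ forall a x y, I x -> I y -> I (a * x + y).
Proof.
split=> -[I0 IP]; split=> [|a x y].
- exact: set_mem I0.
- by move=> /mem_set Ix /mem_set Iy; apply: set_mem (IP a x y Ix Iy).
- exact: mem_set.
- by move=> /set_mem Ix /set_mem Iy; apply: mem_set (IP a x y Ix Iy).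
Qed.

Lemma proper_idealP (D : idomainType) (I : set D) :
  idealr_closed [in I] <-> ideal I /\ ~ I 1.
Proof.
split.
  by case=> I0 I1 IP; split; [split | move=> /mem_set; apply/negP].
by move=> [[I0 IP] nI1]; split=> //; apply/negP => /set_mem.
Qed.

Lemma colon_ideal (D : idomainType) (I : set D) (v : D) :
  ideal I -> ideal [set x | I (x * v)].
Proof.
move=> /idealP[I0 IP]; apply/idealP; split=> [|a x y] /=; first by rewrite mul0r.
by move=> Ix Iy; rewrite mulrDl -mulrA; apply: IP.
Qed.

Lemma ideal_mull (D : idomainType) (I : set D) a x : ideal I -> I x -> I (a * x).
Proof. by move=> /idealP[I0 IP] Ix; rewrite -[_ * _]addr0; apply: IP. Qed.

(** If [u v \in M] and [v \notin M], the ideal [M : v] is proper and contains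
    [M], so it is [M], and it contains [u]. *)
Lemma maximal_ideal_prime (D : idomainType) (M : set D) :
  maximal_ideal M -> prime_ideal M.
Proof.
move=> [propM maxM]; split=> // u v /set_mem Muv.
have [idM _] := (proper_idealP M).1 propM.
have [Mv|nMv] := boolP (v \in M); first by rewrite orbT.
apply/orP; left; apply/mem_set.
rewrite -(maxM [set x | M (x * v)]) //; last first.
  by move=> x Mx; rewrite /= mulrC; apply: ideal_mull.
apply/proper_idealP; split; first exact: colon_ideal.
by rewrite /= mul1r => /mem_set; apply/negP.
Qed.

Lemma proper_ideal_sub_maximal (D : idomainType) (J : set D) :
  ideal J -> ~ J 1 -> exists2 M, maximal_ideal M & J `<=` M.
Proof.
move=> idJ J1.
have [||M [[idM M1] JM maxM]] := @Zorn_above D (fun I => ideal I /\ ~ I 1) J.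
- by [].
- move=> F [X0 FX0] FP tF; split; last by move=> [X /FP[_ X1] /X1].
  apply/idealP; split=> [|a x y [X FX Xx] [Y FY Yy]].
    by exists X0 => //; have [/idealP[]] := FP _ FX0.
  have [Z [FZ XZ YZ]] := chain_upper2 tF FX FY.
  have [/idealP[_ ZP] _] := FP _ FZ.
  by exists Z => //; apply: ZP; auto.
exists M => //; split=> [|I propI MI]; first exact/proper_idealP.
by apply: maxM => //; apply/proper_idealP.
Qed.

Lemma zero_prime (D : idomainType) : prime_ideal [set 0 : D].
Proof.
split.
  apply/proper_idealP; split; last by move=> /= /eqP; rewrite oner_eq0.
  by apply/idealP; split=> // a x y /= -> ->; rewrite mulr0 addr0.
move=> u v /set_mem /= /eqP; rewrite mulf_eq0.
by move=> /orP[]/eqP ->; apply/orP; [left|right]; apply/mem_set.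
Qed.

Lemma dim1_nonzero_prime_sub (D : idomainType) (P Q : set D) (x : D) :
  has_krull_dim D 1 -> prime_ideal P -> prime_ideal Q -> P x -> x != 0 ->
  P `<=` Q -> P = Q.
Proof.
move=> [_ dim] prP prQ Px x0 PQ; apply: contrapT => nPQ.
pose C i := if i is 0 then [set 0] else if i is 1 then P else Q.
suff /dim : prime_chain 2 C by [].
have [/proper_idealP[/idealP[P0 _] _] _] := prP.
split=> [[|[|i]] _ //|[|[|//]] _]; first exact: zero_prime.
- split=> [_ -> //|/(_ x Px)]; exact/eqP.
- by split=> // QP; apply: nPQ; apply/seteqP.
Qed.

(** * Quasi-b-ideals of an integrally closed domain *)

(** The b-closure only sees the extensions of an ideal to the valuation
    overrings; hence conditions imposed separately over each of them cut out a
    quasi-b-ideal. The dependence of [W] on [V] is arbitrary because complete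
    integral closedness uses conditions that come from no single submodule of
    the quotient field. *)
Lemma quasi_b_of_local (D : idomainType)
    (W : set {fraction D} -> set {fraction D}) :
    (forall V, @valuation_overring D V -> W V 0 /\
       forall v x y, V v -> W V x -> W V y -> W V (v * x + y)) ->
    (exists2 d : D, d != 0 & forall V, @valuation_overring D V -> W V (tofrac d)) ->
  quasi_b_ideal [set d : D | forall V, valuation_overring V -> W V (tofrac d)].
Proof.
move=> Wmod [d0 d00 Wd0]; split.
  split; last by exists d0.
  apply/idealP; split=> [V valV|a x y Ix Iy V valV].
    by rewrite tofrac0; have [] := Wmod V valV.
  rewrite tofracD tofracM; have [_ WP] := Wmod V valV.
  by apply: WP; [case: valV => -[_ VD] _; exact: VD|apply: Ix|apply: Iy].
apply/seteqP; split=> [d bd V valV|d Id V valV].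
  have [n [e [v [Ie Vv ->]]]] := bd V valV.
  have [W0 WP] := Wmod V valV.
  elim/big_ind: _ => // [x y Wx Wy|i _].
    have [[/subringP[_ V1 _ _ _] _] _] := valV.
    by rewrite -[x]mul1r; apply: WP.
  have [c Ic <-] := Ie i.
  by rewrite mulrC -[_ * _]addr0; apply: WP => //; apply: Ic.
have [[/subringP[_ V1 _ _ _] _] _] := valV.
exists 1%N, (fun=> tofrac d), (fun=> 1); split=> //.
by rewrite big_ord_recl big_ord0 mulr1 addr0.
Qed.

Section IntegrallyClosed.
Variable D : idomainType.
Hypothesis D_closed : integrally_closed D.

Local Notation K := {fraction D}.
Local Notation D_ := (range (@tofrac D)).

Lemma valuation_intersectionE (z : K) :
  D_ z <-> forall V, @valuation_overring D V -> V z.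
Proof.
split=> [[d _ <-] V [[_ VD] _] //|/integral_of_mem_valuations/D_closed[d ->]].
by exists d.
Qed.

(** As [D] is the intersection of the [V], the condition [d w \in D] splits into
    the conditions [d w \in V]. *)
Lemma divisorial_quasi_b (S : set K) (d0 : D) :
  d0 != 0 -> (forall w, S w -> D_ (tofrac d0 * w)) ->
  quasi_b_ideal [set d : D | forall w, S w -> D_ (tofrac d * w)].
Proof.
move=> d00 Sd0.
rewrite (_ : mkset _ = [set d : D | forall V, @valuation_overring D V ->
    forall w, S w -> V (tofrac d * w)]); last first.
  apply/seteqP; split=> d /= dS => [V valV w Sw|w Sw].
    by apply: (valuation_intersectionE _).1 valV; apply: dS.
  by apply/valuation_intersectionE => V valV; apply: dS.
apply: (@quasi_b_of_local _ (fun V => [set x | forall w, S w -> V (x * w)])).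
  move=> V [[/subringP[V0 V1 VD _ VM] _] _].
  split=> [w _|v x y Vv Wx Wy w Sw]; first by rewrite mul0r.
  by rewrite mulrDl -mulrA; apply: VD; [apply: VM => //; apply: Wx|apply: Wy].
by exists d0 => // V valV w Sw; apply: (valuation_intersectionE _).1 valV; apply: Sd0.
Qed.

(** * Consequences of the chain condition on quasi-b-ideals *)

Hypothesis D_bnoeth : b_noetherian D.

(** In a valuation ring [V] that misses [z], the module generated by
    [a, a z, ..., a z^n] is [a z^n V], because [z^-1 \in V]. So the ideals [J n]
    of the elements of [D] lying in [a z^n V] for all such [V] increase with [n].
    If [J N.+1 = J N], then [a z^(N+1)] lies in [a z^N V], so [z \in V] after
    all. *)
Lemma completely_integrally_closed (a : D) (z : K) :
  a != 0 -> (forall n, D_ (tofrac a * z ^+ n)) -> D_ z.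
Proof.
move=> a0 Daz.
have [->|z0] := eqVneq z 0; first by exists 0; rewrite ?tofrac0.
have ta0 : tofrac a != 0 :> K by rewrite tofrac_eq0.
have taz0 n : tofrac a * z ^+ n != 0 by rewrite mulf_neq0 ?expf_neq0.
have Vzinv V : @valuation_overring D V -> ~ V z -> V z^-1.
  by move=> [_ /(_ z z0)[]].
pose W n (V : set K) := [set x : K | ~ V z -> V (x / (tofrac a * z ^+ n))].
pose J n := [set d : D | forall V, @valuation_overring D V -> W n V (tofrac d)].
have Wmono n V : @valuation_overring D V -> W n V `<=` W n.+1 V.
  move=> valV x Wx nVz.
  have [[/subringP[_ _ _ _ VM] _] _] := valV.
  rewrite exprSr [tofrac a * _]mulrA invfM [x * _]mulrA.
  by apply: VM; [apply: Wx|apply: Vzinv].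
have [n|n d Jd V valV|N JN] := D_bnoeth (I := J).
- apply: quasi_b_of_local => [V [[/subringP[V0 V1 VD _ VM] _] _]|].
    split=> [_|v x y Vv Wx Wy nVz]; first by rewrite mul0r.
    by rewrite mulrDl -mulrA; apply: VD; [apply: VM => //; apply: Wx|apply: Wy].
  exists a => // V valV.
  elim: n => [|n IHn]; last exact: Wmono.
  have [[/subringP[_ V1 _ _ _] _] _] := valV.
  by rewrite /W /= expr0 mulr1 divff.
- by apply: Wmono => //; apply: Jd.
apply/valuation_intersectionE => V valV; apply: contrapT => nVz.
have [d _ dE] := Daz N.+1.
have /(_ V valV nVz) : J N d.
  rewrite -(JN N.+1 (leqnSn N)) => V' valV' _; rewrite dE divff //.
  by have [[/subringP[]]] := valV'.
by rewrite dE exprS mulrCA mulfK.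
Qed.

(** Choose [z] such that the conductor [Q z = (D : z)] is maximal among the
    conductors contained in [M]. For [s \notin M] the conductor [Q (s z)] is still
    contained in [M], because [M] is prime, so it equals [Q z]. For [x y \in Q z]
    the element [x] is in [Q (y z)]; either this conductor is contained in [M],
    hence equal to [Q z], or it contains some [s \notin M], and then
    [y \in Q (s z) = Q z]. So [Q z] is prime. The conductors are required to
    contain a fixed nonzero [a \in M] so that they are nonzero ideals; the
    conductor of [1/a], which is [a D], starts the search. *)
Lemma minimal_prime_multiplier (M : set D) :
    prime_ideal M ->
    (forall P x, prime_ideal P -> P x -> x != 0 -> P `<=` M -> P = M) ->
    (exists2 a, M a & a != 0) ->
  exists2 z : K, ~ D_ z & forall m, M m -> D_ (tofrac m * z).
Proof.
move=> [propM primeM] minM [a Ma a0].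
have [idM M1] := (proper_idealP M).1 propM.
pose Q (z : K) := [set d : D | D_ (tofrac d * z)].
have idQ z : ideal (Q z).
  apply/idealP; split=> [|c x y [e _ ex] [g _ gy]].
    by exists 0 => //; rewrite tofrac0 mul0r.
  exists (c * e + g) => //.
  by rewrite !(tofracD, tofracM) mulrDl -mulrA ex gy.
have Qmul z s x : Q z (x * s) <-> Q (tofrac s * z) x.
  by rewrite /Q /= tofracM mulrA.
pose C := [set I | exists2 z, I = Q z & Q z `<=` M /\ Q z a].
have [||I [z -> [QM Qa] maxQ]] := acc_maximal (C' := C) D_bnoeth.
- move=> _ [z -> [QM Qa]].
  have -> : Q z = [set d : D | forall w, [set z] w -> D_ (tofrac d * w)].
    by apply/seteqP; split=> [d Qd _ -> //|d]; apply.
  by apply: (divisorial_quasi_b a0) => _ ->.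
- exists (Q (tofrac a)^-1), (tofrac a)^-1 => //; split.
    move=> d [e _ ed].
    have /eqP : tofrac d = tofrac (e * a).
      by rewrite tofracM ed divfK // tofrac_eq0.
    rewrite tofrac_eq => /eqP ->.
    exact: ideal_mull.
  by exists 1; rewrite // tofrac1 divff // tofrac_eq0.
have Qscale s : ~ M s -> Q (tofrac s * z) = Q z.
  move=> nMs; have Qs d : Q z d -> Q (tofrac s * z) d.
    by move=> Qd; apply/Qmul; rewrite mulrC; apply: ideal_mull.
  apply: maxQ => //; exists (tofrac s * z) => //; split; last exact: Qs.
  move=> d /Qmul/QM/mem_set/primeM/orP[]/set_mem //.
have primeQ : prime_ideal (Q z).
  split; first by apply/proper_idealP; split=> // /QM.
  move=> x y /set_mem Qxy; apply/orP.
  have [Qy|nQy] := pselect (Q z y); [right|left]; apply/mem_set => //.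
  have [Qym|] := pselect (Q (tofrac y * z) `<=` M).
    rewrite -(maxQ (Q (tofrac y * z))); first exact/Qmul.
      exists (tofrac y * z) => //; split=> //.
      by apply/Qmul; rewrite mulrC; apply: ideal_mull.
    by move=> d Qd; apply/Qmul; rewrite mulrC; apply: ideal_mull.
  move=> /existsNP[s /not_implyP[/Qmul Qsy nMs]].
  by case: nQy; rewrite -(Qscale s nMs); apply/Qmul; rewrite mulrC.
have QeqM := minM _ a primeQ Qa a0 QM.
exists z => [Dz|m]; last by rewrite -{1}QeqM.
by apply: M1; apply: QM; rewrite /Q /= tofrac1 mul1r.
Qed.

Hypothesis D_dim1 : has_krull_dim D 1.

(** With [d] a counterexample and [M] a maximal ideal containing
    [I : d], any [w] with [I w] inside [D] satisfies [(i w) d = i (d w) \in I], so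
    [I w] is inside [M], and a multiplier [z] of [M] keeps [I w z] inside [D]. *)
Lemma nonzero_ideal_divisorial (I : set D) (d : D) :
    nonzero_ideal I ->
    (forall w : K, (forall i, I i -> D_ (tofrac i * w)) -> D_ (tofrac d * w)) ->
  I d.
Proof.
move=> [idI [a Ia a0]] dI; apply: contrapT => nId.
have [||M maxM QM] := @proper_ideal_sub_maximal _ [set x | I (x * d)].
- exact: colon_ideal.
- by rewrite /= mul1r.
have primeM := maximal_ideal_prime maxM.
have Ma : M a by apply: QM; rewrite /= mulrC; apply: ideal_mull.
have [||z nDz Mz] := minimal_prime_multiplier primeM.
- move=> P x primeP Px x0 PM.
  exact: (dim1_nonzero_prime_sub D_dim1 primeP primeM Px x0 PM).
- by exists a.
apply: nDz; apply: (@completely_integrally_closed a z a0) => n.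
suff DIz i : I i -> D_ (tofrac i * z ^+ n) by apply: DIz.
elim: n i => [|n IHn] i Ii; first by exists i; rewrite // expr0 mulr1.
have [e _ ed] := dI _ IHn.
have [c _ ci] := IHn i Ii.
have /Mz[g _ gE] : M c.
  apply: QM; rewrite /= (_ : c * d = e * i); first exact: ideal_mull.
  by apply/eqP; rewrite -tofrac_eq !tofracM ci ed mulrC mulrCA mulrC.
by exists g; rewrite // gE ci exprSr mulrA.
Qed.

(** The chain condition on quasi-b-ideals concerns nonzero ideals, so a chain of
    ideals is first shifted past its zero terms. *)
Lemma b_noetherian_noetherian : noetherian D.
Proof.
have qb (I : set D) : nonzero_ideal I -> quasi_b_ideal I.
  move=> nzI.
  pose S := [set w : K | forall i, I i -> D_ (tofrac i * w)].
  have [idI [a Ia a0]] := nzI.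
  have -> : I = [set d : D | forall w, S w -> D_ (tofrac d * w)].
    apply/seteqP; split=> [d Id w|d]; first exact.
    exact: nonzero_ideal_divisorial.
  by apply: (@divisorial_quasi_b _ a a0) => w Sw; apply: Sw.
move=> I idI Imono.
have le m n : (m <= n)%N -> I m `<=` I n.
  by move=> /subnK <-; elim: (n - m)%N => // k IH; apply: subset_trans (Imono _).
have [[k [x Ikx x0]]|I0] := pselect (exists k, exists2 x, I k x & x != 0).
  have [n|n|N IN] := D_bnoeth (I := fun n => I (n + k)%N).
  - by apply: qb; split=> //; exists x => //; apply: (le k) => //; apply: leq_addl.
  - exact: Imono.
  exists (N + k)%N => n len.
  rewrite -(subnK (leq_trans (leq_addl N k) len)); apply: IN.
  by rewrite leq_subRL ?(leq_trans (leq_addl N k) len) // addnC.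
exists 0%N => n _.
suff I0E m : I m = [set 0] by rewrite !I0E.
apply/seteqP; split=> [x Ix|_ ->]; last by have /idealP[] := idI m.
by apply: contrapT => /eqP x0; apply: I0; exists m, x.
Qed.

End IntegrallyClosed.

(** * Dimension one and the Dedekind property *)

Lemma dim1_prime_maximal (D : idomainType) (P : set D) :
  has_krull_dim D 1 -> prime_ideal P -> P <> [set 0] -> maximal_ideal P.
Proof.
move=> dim1 primeP Pn0.
have [propP _] := primeP; have [idP _] := (proper_idealP P).1 propP.
have [P0 _] := (idealP P).1 idP.
have [x Px x0] : exists2 x, P x & x != 0.
  apply: contrapT => nx; apply: Pn0; apply/seteqP; split=> [x Px|_ -> //].
  by apply: contrapT => /eqP x0; apply: nx; exists x.
split=> // J /proper_idealP[idJ J1] PJ.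
have [M maxM JM] := proper_ideal_sub_maximal idJ J1.
have PM : P = M.
  apply: (dim1_nonzero_prime_sub dim1 primeP _ Px x0); last exact: subset_trans JM.
  exact: maximal_ideal_prime.
by apply/seteqP; split=> //; rewrite PM.
Qed.

Lemma dedekind_dim1 (D : idomainType) :
  dedekind D -> ~ is_field D -> has_krull_dim D 1.
Proof.
move=> [_ _ maxD] nfield; split.
  have [x] : exists x : D, ~ (x != 0 -> x \is a GRing.unit) by apply/existsNP.
  move=> /not_implyP[x0 nux].
  have idx : ideal [set y : D | exists c, y = c * x].
    apply/idealP; split=> [|a _ _ [c ->] [e ->]]; first by exists 0; rewrite mul0r.
    by exists (a * c + e); rewrite mulrDl mulrA.
  have [[c cx]|M maxM xM] := proper_ideal_sub_maximal idx.
    by apply: nux; apply/unitrPr; exists c; rewrite mulrC.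
  exists (fun i => if i is 0 then [set 0] else M); split.
    by move=> [|i] _; [apply: zero_prime | apply: maximal_ideal_prime].
  move=> [_|//]; have /proper_idealP[/idealP[M0 _] _] := maxM.1.
  split=> [_ -> //|/(_ x)]; have Mx : M x by apply: xM; exists 1; rewrite mul1r.
  by move=> /(_ Mx) /eqP; apply/negP.
move=> [|[|m]] P [primeP ltP] //.
have [lt01 lt12] := (ltP 0 isT, ltP 1%N isT).
have max1 : maximal_ideal (P 1%N).
  apply: maxD; first exact: primeP.
  move=> P10; case: lt01 => _ nP10; apply: nP10; rewrite P10 => _ ->.
  by have [/proper_idealP[/idealP[]]] := primeP 0 isT.
have [prop2 _] := primeP 2%N isT.
by case: lt12 => P12 nP21; case: nP21; rewrite (max1.2 _ prop2 P12).
Qed.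

Lemma noetherian_b_noetherian (D : idomainType) : noetherian D -> b_noetherian D.
Proof. by move=> noeth I qbI; apply: noeth => n; have [[]] := qbI n. Qed.

Lemma dim1_not_field (D : idomainType) : has_krull_dim D 1 -> ~ is_field D.
Proof.
move=> [[P [primeP ltP]] _] field.
have [[prop0 _] [prop1 _]] := (primeP 0 isT, primeP 1%N isT).
have [[id0 _] [id1 P1]] := ((proper_idealP _).1 prop0, (proper_idealP _).1 prop1).
have [_] := ltP 0 isT; apply => x P1x.
have [->|x0] := eqVneq x 0; first by have [] := (idealP _).1 id0.
by case: P1; rewrite -(mulVr (field x x0)); apply: ideal_mull.
Qed.

Theorem theorem18 (D : idomainType) :
  (has_krull_dim D 1 /\ integrally_closed D /\ b_noetherian D) <->
  (dedekind D /\ ~ is_field D).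
Proof.
split=> [[dim1 [closed bnoeth]]|[dedD nfield]].
  split; last exact: dim1_not_field.
  split=> //; first exact: b_noetherian_noetherian.
  by move=> P; apply: dim1_prime_maximal.
split; first exact: dedekind_dim1.
by have [noeth closed _] := dedD; split=> //; apply: noetherian_b_noetherian.
Qed.
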